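(* Let $k$ be an algebraically closed field. (1) For every $n\ge 1$ and every $c\in M_n(k)$, the extension $S_n(c,k)\subseteq M_n(k)$ is a separable Frobenius extension, where $S_n(c,k)=\{a\in M_n(k)\mid ac=ca\}$. (2) If $c\in\Lambda:=M_{n_1}(k)\times M_{n_2}(k)\times\cdots\times M_{n_s}(k)$, then $S(c,\Lambda)\subseteq\Lambda$ is a separable Frobenius extension, where $S(c,\Lambda)=\{a\in\Lambda\mid ac=ca\}$.
   Context: An extension $B\subseteq A$ of rings means that $B$ is a subring of $A$ with the same identity. It is a Frobenius extension if ${}_BA$ is a finitely generated projective left $B$-module and $\mathrm{Hom}_B({}_BA,B)\simeq {}_AA_B$ as $A$-$B$-bimodules. It is separable if the multiplication map $A\otimes_BA\to A$, $x\otimes y\mapsto xy$, is a split surjection of $A$-$A$-bimodules. Here $s\ge1$ and $n_1,\dots,n_s\ge 1$ are integers. *)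

(* Defs.v *)
From HB Require Import structures.
From mathcomp Require Import all_boot all_order all_algebra.
From mathcomp Require Import generic_quotient ring_quotient boolp freeg.

Set Implicit Arguments.
Unset Strict Implicit.
Unset Printing Implicit Defensive.

Import GRing.Theory.

Local Open Scope ring_scope.
Local Open Scope quotient_scope.

Reserved Notation "v *:> b" (at level 40, left associativity).

(* All rings are unital, not necessarily commutative; the trivial ring is
   allowed because 'M[R]_n is only known to be nontrivial when n is a
   successor. *)

HB.mixin Record Lmodule_isBimodule (R S : pzRingType) M of GRing.Lmodule R M := {
  rscale : M -> S -> M;
  rscalerA : forall v a b, rscale (rscale v a) b = rscale v (a * b);
  rscaler1 : forall v, rscale v 1 = v;
  rscalerDl : forall u v a, rscale (u + v) a = rscale u a + rscale v a;
  rscalerDr : forall v a b, rscale v (a + b) = rscale v a + rscale v b;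
  scaler_rscaler : forall (a : R) v b, rscale (a *: v) b = a *: rscale v b
}.

#[short(type="bimodType")]
HB.structure Definition Bimodule (R S : pzRingType) :=
  {M of GRing.Lmodule R M & Lmodule_isBimodule R S M}.

Notation "v *:> b" := (rscale v b) : ring_scope.

Definition bimod_morphism (R S : pzRingType) (M N : bimodType R S)
    (f : M -> N) : Prop :=
  linear f /\ forall v b, f (v *:> b) = f v *:> b.

Definition bimod_isomorphic (R S : pzRingType) (M N : bimodType R S) : Prop :=
  exists f : M -> N, bimod_morphism f /\ bijective f.

Definition split_surjection (R S : pzRingType) (M N : bimodType R S)
    (f : M -> N) : Prop :=
  bimod_morphism f /\ exists g : N -> M, bimod_morphism g /\ cancel g f.

Definition finitely_generated (R : pzRingType) (M : lmodType R) : Prop :=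
  exists (n : nat) (e : 'I_n -> M),
    forall x, exists c : 'I_n -> R, x = \sum_i c i *: e i.

Definition projective (R : pzRingType) (M : lmodType R) : Prop :=
  forall (P Q : lmodType R) (p : {linear P -> Q}) (h : {linear M -> Q}),
    (forall y, exists x, p x = y) ->
    exists g : {linear M -> P}, forall x, p (g x) = h x.

(* The ring A as an R-S-bimodule by restriction of scalars along
   f : R -> A and g : S -> A. *)
Definition restr_bimod (R S A : pzRingType)
  (f : {rmorphism R -> A}) (g : {rmorphism S -> A}) : Type := A.

Section RestrBimod.
Variables (R S A : pzRingType) (f : {rmorphism R -> A}) (g : {rmorphism S -> A}).
Local Notation M := (restr_bimod f g).

HB.instance Definition _ := GRing.Zmodule.copy M A.

Definition restr_scale (a : R) (x : M) : M := f a * (x : A).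
Definition restr_rscale (x : M) (b : S) : M := (x : A) * g b.

Fact restr_scaleA a b x :
  restr_scale a (restr_scale b x) = restr_scale (a * b) x.
Proof. by rewrite /restr_scale rmorphM mulrA. Qed.
Fact restr_scale1 : left_id 1 restr_scale.
Proof. by move=> x; rewrite /restr_scale rmorph1 mul1r. Qed.
Fact restr_scaleDr : right_distributive restr_scale +%R.
Proof. by move=> a x y; apply: mulrDr. Qed.
Fact restr_scaleDl x : {morph restr_scale^~ x : a b / a + b}.
Proof. by move=> a b; rewrite /restr_scale rmorphD; apply: mulrDl. Qed.

HB.instance Definition _ := GRing.Zmodule_isLmodule.Build R M
  restr_scaleA restr_scale1 restr_scaleDr restr_scaleDl.

Fact restr_rscaleA v a b :
  restr_rscale (restr_rscale v a) b = restr_rscale v (a * b).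
Proof. by rewrite /restr_rscale rmorphM mulrA. Qed.
Fact restr_rscale1 v : restr_rscale v 1 = v.
Proof. by rewrite /restr_rscale rmorph1 mulr1. Qed.
Fact restr_rscaleDl u v a :
  restr_rscale (u + v) a = restr_rscale u a + restr_rscale v a.
Proof. exact: mulrDl. Qed.
Fact restr_rscaleDr v a b :
  restr_rscale v (a + b) = restr_rscale v a + restr_rscale v b.
Proof. by rewrite /restr_rscale rmorphD; apply: mulrDr. Qed.
Fact restr_scale_rscale (a : R) v b :
  restr_rscale (a *: v) b = a *: restr_rscale v b.
Proof. exact: esym (mulrA _ _ _). Qed.

HB.instance Definition _ := Lmodule_isBimodule.Build R S M
  restr_rscaleA restr_rscale1 restr_rscaleDl restr_rscaleDr restr_scale_rscale.

End RestrBimod.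

(* Hom_R(M, N) for an R-S-bimodule M and an R-T-bimodule N: an S-T-bimodule
   under (a f b)(x) = f(x a) b. *)
Definition lhom (R S T : pzRingType) (M : bimodType R S) (N : bimodType R T) :=
  {linear M -> N}.

Section Lhom.
Variables (R S T : pzRingType) (M : bimodType R S) (N : bimodType R T).
Local Notation H := (lhom M N).
Implicit Types (f g : H) (x : M).

Definition lhom_app f : M -> N := (f : {linear M -> N}).

Lemma lhomP f g : lhom_app f =1 lhom_app g -> f = g.
Proof.
rewrite /lhom_app; case: f g => [f Hf] [g Hg] /= /funext fg; subst g.
case: Hf Hg => [[af] [sf]] [[ag] [sg]].
by rewrite (Prop_irrelevance af ag) (Prop_irrelevance sf sg).
Qed.

HB.instance Definition _ := gen_eqMixin H.
HB.instance Definition _ := gen_choiceMixin H.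

Fact lhom_app_linear f : linear (lhom_app f).
Proof. exact: linearP. Qed.

Definition mk_lhom (h : M -> N) (hl : linear h) : H :=
  HB.pack_for {linear M -> N} h (GRing.isLinear.Build R M N _ h hl).

Lemma mk_lhomE h hl x : lhom_app (@mk_lhom h hl) x = h x.
Proof. by []. Qed.

Fact lhom0_linear : linear (fun _ : M => 0 : N).
Proof. by move=> a x y; rewrite scaler0 addr0. Qed.
Fact lhomN_linear f : linear (fun x => - lhom_app f x).
Proof. by move=> a x y; rewrite lhom_app_linear opprD scalerN. Qed.
Fact lhomD_linear f g : linear (fun x => lhom_app f x + lhom_app g x).
Proof. by move=> a x y; rewrite !lhom_app_linear scalerDr addrACA. Qed.

Definition lhom0 : H := mk_lhom lhom0_linear.
Definition lhomN f : H := mk_lhom (lhomN_linear f).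
Definition lhomD f g : H := mk_lhom (lhomD_linear f g).

Fact lhomDA : associative lhomD.
Proof. by move=> f g h; apply: lhomP => x; rewrite !mk_lhomE addrA. Qed.
Fact lhomDC : commutative lhomD.
Proof. by move=> f g; apply: lhomP => x; rewrite !mk_lhomE addrC. Qed.
Fact lhom0D : left_id lhom0 lhomD.
Proof. by move=> f; apply: lhomP => x; rewrite !mk_lhomE add0r. Qed.
Fact lhomND : left_inverse lhom0 lhomN lhomD.
Proof. by move=> f; apply: lhomP => x; rewrite !mk_lhomE addNr. Qed.

HB.instance Definition _ := GRing.isZmodule.Build H lhomDA lhomDC lhom0D lhomND.

Fact lhomZ_linear (a : S) f : linear (fun x => lhom_app f (x *:> a)).
Proof.
by move=> c x y; rewrite rscalerDl scaler_rscaler lhom_app_linear.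
Qed.
Fact lhomR_linear f (b : T) : linear (fun x => lhom_app f x *:> b).
Proof.
by move=> c x y; rewrite lhom_app_linear rscalerDl scaler_rscaler.
Qed.

Definition lhomZ (a : S) f : H := mk_lhom (lhomZ_linear a f).
Definition lhomR f (b : T) : H := mk_lhom (lhomR_linear f b).

Fact lhomZA a b f : lhomZ a (lhomZ b f) = lhomZ (a * b) f.
Proof. by apply: lhomP => x; rewrite !mk_lhomE rscalerA. Qed.
Fact lhomZ1 : left_id 1 lhomZ.
Proof. by move=> f; apply: lhomP => x; rewrite !mk_lhomE rscaler1. Qed.
Fact lhomZDr : right_distributive lhomZ +%R.
Proof. by move=> a f g; apply: lhomP. Qed.
Fact lhomZDl f : {morph lhomZ^~ f : a b / a + b}.
Proof.
move=> a b; apply: lhomP => x; rewrite !mk_lhomE rscalerDr.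
exact: (raddfD (f : {linear M -> N})).
Qed.

HB.instance Definition _ := GRing.Zmodule_isLmodule.Build S H
  lhomZA lhomZ1 lhomZDr lhomZDl.

Fact lhomRA f a b : lhomR (lhomR f a) b = lhomR f (a * b).
Proof. by apply: lhomP => x; rewrite !mk_lhomE rscalerA. Qed.
Fact lhomR1 f : lhomR f 1 = f.
Proof. by apply: lhomP => x; rewrite !mk_lhomE rscaler1. Qed.
Fact lhomRDl f g a : lhomR (f + g) a = lhomR f a + lhomR g a.
Proof. by apply: lhomP => x; rewrite !mk_lhomE rscalerDl. Qed.
Fact lhomRDr f a b : lhomR f (a + b) = lhomR f a + lhomR f b.
Proof. by apply: lhomP => x; rewrite !mk_lhomE rscalerDr. Qed.
Fact lhomZR (a : S) f b : lhomR (a *: f) b = a *: lhomR f b.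
Proof. by apply: lhomP. Qed.

HB.instance Definition _ := Lmodule_isBimodule.Build S T H
  lhomRA lhomR1 lhomRDl lhomRDr lhomZR.

Lemma lhom_scaleE (a : S) f x : lhom_app (a *: f) x = lhom_app f (x *:> a).
Proof. by []. Qed.
Lemma lhom_rscaleE f (b : T) x : lhom_app (f *:> b) x = lhom_app f x *:> b.
Proof. by []. Qed.

End Lhom.

(* M (x)_S N as the free abelian group on M * N modulo the subgroup generated
   by the usual relations. *)
Section TensorGroup.
Variables (R S T : pzRingType) (M : bimodType R S) (N : bimodType S T).
Local Notation F := {freeg (M * N)%type / int}.

Inductive tensor_rel : F -> Prop :=
| TensorRelDl m m' n :
    tensor_rel (<< (m + m', n) >> - << (m, n) >> - << (m', n) >>)
| TensorRelDr m n n' :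
    tensor_rel (<< (m, n + n') >> - << (m, n) >> - << (m, n') >>)
| TensorRelZ m (a : S) n :
    tensor_rel (<< (m *:> a, n) >> - << (m, a *: n) >>)
| TensorRel0 : tensor_rel 0
| TensorRelB x y : tensor_rel x -> tensor_rel y -> tensor_rel (x - y).

Definition tensor_null : {pred F} := fun x => `[< tensor_rel x >].

Fact tensor_null_closed : zmod_closed tensor_null.
Proof.
split; first by apply/asboolP; apply: TensorRel0.
by move=> x y /asboolP hx /asboolP hy; apply/asboolP; apply: TensorRelB.
Qed.

HB.instance Definition _ := GRing.isZmodClosed.Build F tensor_null
  tensor_null_closed.

Definition tensor : Type := @Quotient.quot F tensor_null.

HB.instance Definition _ := GRing.Zmodule.on tensor.

Definition tens (m : M) (n : N) : tensor :=
  \pi_(@Quotient.quot F tensor_null) << (m, n) >>.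

Definition balanced (V : zmodType) (f : M -> N -> V) : Prop :=
  [/\ forall m m' n, f (m + m') n = f m n + f m' n,
      forall m n n', f m (n + n') = f m n + f m n' &
      forall m (a : S) n, f (m *:> a) n = f m (a *: n)].

(* The additive map sending tens m n to f m n; meaningful for balanced f. *)
Definition tensor_lift (V : zmodType) (f : M -> N -> V) (x : tensor) : V :=
  fglift (fun mn => f mn.1 mn.2 : zmodule V)
    (repr (x : @Quotient.quot F tensor_null)).

Local Notation piQ := (\pi_(@Quotient.quot F tensor_null)).

Lemma tensor_rel_eq (x y : F) : tensor_rel (x - y) -> piQ x = piQ y.
Proof.
by move=> h; apply/eqP; rewrite -Quotient.idealrBE; apply/asboolP.
Qed.

Lemma tens_balanced : balanced tens.
Proof.
split=> [m m' n | m n n' | m a n]; rewrite /tens.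
- rewrite -[RHS](raddfD piQ).
  by apply: tensor_rel_eq; rewrite opprD addrA; apply: TensorRelDl.
- rewrite -[RHS](raddfD piQ).
  by apply: tensor_rel_eq; rewrite opprD addrA; apply: TensorRelDr.
- by apply: tensor_rel_eq; apply: TensorRelZ.
Qed.

Lemma tensDl m m' n : tens (m + m') n = tens m n + tens m' n.
Proof. by case: tens_balanced. Qed.
Lemma tensDr m n n' : tens m (n + n') = tens m n + tens m n'.
Proof. by case: tens_balanced. Qed.
Lemma tensZ m (a : S) n : tens (m *:> a) n = tens m (a *: n).
Proof. by case: tens_balanced. Qed.

Lemma tensor_ind (P : tensor -> Prop) :
  (forall m n, P (tens m n)) -> P 0 ->
  (forall x y, P x -> P y -> P (x + y)) -> (forall x, P x -> P (- x)) ->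
  forall x, P x.
Proof.
move=> Pt P0 PD PN x; rewrite -[x](@reprK _ (@Quotient.quot F tensor_null)).
rewrite -[X in piQ X]freeg_sumE (raddf_sum piQ).
elim/big_ind: _ => // -[m n] _ /=; set c := coeff _ _.
have Pn k : P (piQ << k%:Z *g (m, n) >>).
  elim: k => [|k IHk]; first by rewrite freegU0 (raddf0 piQ); exact: P0.
  by rewrite -add1n PoszD -freegUD (raddfD piQ); exact: PD (Pt m n) IHk.
case: c => k; first exact: Pn.
rewrite NegzE -freegUN (raddfN piQ); exact: PN (Pn k.+1).
Qed.

Section Lift.
Variables (V : zmodType) (f : M -> N -> V).
Hypothesis fP : balanced f.

Let fl : F -> V := fglift (fun mn => f mn.1 mn.2 : zmodule V).

Let flB : {morph fl : x y / x - y}.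
Proof. by move=> x y; apply: (lift_is_additive (M := zmodule V)). Qed.

Let fl_tens m n : fl << (m, n) >> = f m n.
Proof. by rewrite /fl liftU scale1r. Qed.

Let fl_rel x : tensor_rel x -> fl x = 0.
Proof.
have [fDl fDr fZ] := fP.
elim=> [m m' n | m n n' | m a n | | {}x y _ fx _ fy].
- by rewrite !flB !fl_tens fDl -addrA -opprD subrr.
- by rewrite !flB !fl_tens fDr -addrA -opprD subrr.
- by rewrite !flB !fl_tens fZ subrr.
- by have := flB 0 0; rewrite !subrr.
- by rewrite flB fx fy subrr.
Qed.

Let lift_pi x : tensor_lift f (piQ x) = fl x.
Proof.
have h : repr (piQ x) - x \in tensor_null by rewrite Quotient.idealrBE reprK.
have := fl_rel (asboolW h); rewrite flB => /eqP.
by rewrite subr_eq0 => /eqP.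
Qed.

Lemma tensor_lift_tens m n : tensor_lift f (tens m n) = f m n.
Proof. by rewrite lift_pi fl_tens. Qed.

Lemma tensor_liftB : {morph tensor_lift f : x y / x - y}.
Proof.
move=> x y; rewrite -[x](@reprK _ (@Quotient.quot F tensor_null)).
rewrite -[y](@reprK _ (@Quotient.quot F tensor_null)).
by rewrite -(raddfB piQ) !lift_pi flB.
Qed.

Lemma tensor_lift0 : tensor_lift f 0 = 0.
Proof. by have := tensor_liftB 0 0; rewrite !subrr. Qed.
Lemma tensor_liftN : {morph tensor_lift f : x / - x}.
Proof. by move=> x; rewrite -[- x]sub0r tensor_liftB tensor_lift0 sub0r. Qed.
Lemma tensor_liftD : {morph tensor_lift f : x y / x + y}.
Proof. by move=> x y; rewrite -{1}[y]opprK tensor_liftB tensor_liftN opprK. Qed.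

End Lift.

End TensorGroup.

Section TensorBimod.
Variables (R S T : pzRingType) (M : bimodType R S) (N : bimodType S T).
Local Notation X := (tensor M N).

Definition tensor_scale (a : R) (x : X) : X :=
  tensor_lift (fun m n => tens (a *: m) n) x.
Definition tensor_rscale (x : X) (b : T) : X :=
  tensor_lift (fun m n => tens m (n *:> b)) x.

Fact scale_balanced (a : R) :
  balanced (fun (m : M) (n : N) => tens (a *: m) n).
Proof.
split=> [m m' n | m n n' | m b n]; first by rewrite scalerDr tensDl.
  exact: tensDr.
by rewrite -scaler_rscaler tensZ.
Qed.

Fact rscale_balanced (b : T) :
  balanced (fun (m : M) (n : N) => tens m (n *:> b)).
Proof.
split=> [m m' n | m n n' | m a n]; first exact: tensDl.
  by rewrite rscalerDl tensDr.
by rewrite scaler_rscaler tensZ.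
Qed.

Lemma tensor_scale_tens a m n : tensor_scale a (tens m n) = tens (a *: m) n.
Proof. exact: tensor_lift_tens (scale_balanced a) m n. Qed.
Lemma tensor_rscale_tens m n b : tensor_rscale (tens m n) b = tens m (n *:> b).
Proof. exact: tensor_lift_tens (rscale_balanced b) m n. Qed.

Fact tensor_scale0 a : tensor_scale a 0 = 0.
Proof. exact: tensor_lift0 (scale_balanced a). Qed.
Fact tensor_scaleN a x : tensor_scale a (- x) = - tensor_scale a x.
Proof. exact: tensor_liftN (scale_balanced a) x. Qed.
Fact tensor_scaleDr : right_distributive tensor_scale +%R.
Proof. move=> a x y; exact: tensor_liftD (scale_balanced a) x y. Qed.
Fact tensor_rscale0 b : tensor_rscale 0 b = 0.
Proof. exact: tensor_lift0 (rscale_balanced b). Qed.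
Fact tensor_rscaleN x b : tensor_rscale (- x) b = - tensor_rscale x b.
Proof. exact: tensor_liftN (rscale_balanced b) x. Qed.
Fact tensor_rscaleDl x y b :
  tensor_rscale (x + y) b = tensor_rscale x b + tensor_rscale y b.
Proof. exact: tensor_liftD (rscale_balanced b) x y. Qed.

Fact tensor_scaleA a b x :
  tensor_scale a (tensor_scale b x) = tensor_scale (a * b) x.
Proof.
elim/tensor_ind: x => [m n | | x y hx hy | x hx].
- by rewrite !tensor_scale_tens scalerA.
- by rewrite !tensor_scale0.
- by rewrite !tensor_scaleDr hx hy.
- by rewrite !tensor_scaleN hx.
Qed.
Fact tensor_scale1 : left_id 1 tensor_scale.
Proof.
elim/tensor_ind=> [m n | | x y hx hy | x hx].
- by rewrite tensor_scale_tens scale1r.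
- exact: tensor_scale0.
- by rewrite tensor_scaleDr hx hy.
- by rewrite tensor_scaleN hx.
Qed.
Fact tensor_scaleDl x : {morph tensor_scale^~ x : a b / a + b}.
Proof.
move=> a b; elim/tensor_ind: x => [m n | | x y hx hy | x hx].
- by rewrite !tensor_scale_tens scalerDl tensDl.
- by rewrite !tensor_scale0 addr0.
- by rewrite !tensor_scaleDr hx hy addrACA.
- by rewrite !tensor_scaleN hx opprD.
Qed.

HB.instance Definition _ := GRing.Zmodule_isLmodule.Build R X
  tensor_scaleA tensor_scale1 tensor_scaleDr tensor_scaleDl.

Fact tensor_rscaleA x a b :
  tensor_rscale (tensor_rscale x a) b = tensor_rscale x (a * b).
Proof.
elim/tensor_ind: x => [m n | | x y hx hy | x hx].
- by rewrite !tensor_rscale_tens rscalerA.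
- by rewrite !tensor_rscale0.
- by rewrite !tensor_rscaleDl hx hy.
- by rewrite !tensor_rscaleN hx.
Qed.
Fact tensor_rscale1 x : tensor_rscale x 1 = x.
Proof.
elim/tensor_ind: x => [m n | | x y hx hy | x hx].
- by rewrite tensor_rscale_tens rscaler1.
- exact: tensor_rscale0.
- by rewrite tensor_rscaleDl hx hy.
- by rewrite tensor_rscaleN hx.
Qed.
Fact tensor_rscaleDr x a b :
  tensor_rscale x (a + b) = tensor_rscale x a + tensor_rscale x b.
Proof.
elim/tensor_ind: x => [m n | | x y hx hy | x hx].
- by rewrite !tensor_rscale_tens rscalerDr tensDr.
- by rewrite !tensor_rscale0 addr0.
- by rewrite !tensor_rscaleDl hx hy addrACA.
- by rewrite !tensor_rscaleN hx opprD.
Qed.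
Fact tensor_scale_rscale (a : R) x b :
  tensor_rscale (a *: x) b = a *: tensor_rscale x b.
Proof.
rewrite -![_ *: _]/(tensor_scale a _).
elim/tensor_ind: x => [m n | | x y hx hy | x hx].
- by rewrite !(tensor_scale_tens, tensor_rscale_tens).
- by rewrite !(tensor_scale0, tensor_rscale0).
- by rewrite !(tensor_scaleDr, tensor_rscaleDl) hx hy.
- by rewrite !(tensor_scaleN, tensor_rscaleN) hx.
Qed.

HB.instance Definition _ := Lmodule_isBimodule.Build R T X
  tensor_rscaleA tensor_rscale1 tensor_rscaleDl tensor_rscaleDr
  tensor_scale_rscale.

Lemma scale_tens (a : R) (m : M) (n : N) : a *: tens m n = tens (a *: m) n.
Proof. exact: tensor_scale_tens. Qed.
Lemma rscale_tens (m : M) (n : N) (b : T) : tens m n *:> b = tens m (n *:> b).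
Proof. exact: tensor_rscale_tens. Qed.

End TensorBimod.

(* A ring extension B <= A is a ring B with a subring structure in A, with
   inclusion map val. *)
Section Extension.
Variables (A : pzRingType) (P : pred A) (B : subPzRingType P).

Local Notation incl := (val : {rmorphism B -> A}).
Local Notation idA := (idfun : {rmorphism A -> A}).
Local Notation idB := (idfun : {rmorphism B -> B}).

Definition frobenius_extension : Prop :=
  [/\ @finitely_generated B (restr_bimod incl idA),
      @projective B (restr_bimod incl idA) &
      @bimod_isomorphic A B
        (lhom (restr_bimod incl idA) (restr_bimod idB idB))
        (restr_bimod idA incl)].

Definition mult (x : restr_bimod idA incl) (y : restr_bimod incl idA) :
  restr_bimod idA idA := (x : A) * (y : A).

Definition mult_map :
    tensor (restr_bimod idA incl) (restr_bimod incl idA) ->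
    restr_bimod idA idA :=
  tensor_lift mult.

Fact mult_balanced : balanced mult.
Proof.
split=> [x x' y | x y y' | x b y]; [exact: mulrDl | exact: mulrDr |].
exact: esym (mulrA _ _ _).
Qed.

Lemma mult_map_tens x y : mult_map (tens x y) = mult x y.
Proof. exact: (tensor_lift_tens mult_balanced). Qed.

Definition separable_extension : Prop := @split_surjection A A _ _ mult_map.

End Extension.

Section Centralizer.
Variables (A : pzRingType) (c : A).

Definition centralizes : {pred A} := fun a => a * c == c * a.

Fact centralizes_subring : subring_closed centralizes.
Proof.
split=> [|a b /eqP ha /eqP hb|a b /eqP ha /eqP hb]; apply/eqP.
- by rewrite mul1r mulr1.
- by rewrite mulrBl mulrBr ha hb.
- by rewrite -mulrA hb mulrA ha mulrA.
Qed.

Definition centralizer : Type := {a : A | centralizes a}.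

HB.instance Definition _ := SubChoice.copy centralizer {a : A | centralizes a}.
HB.instance Definition _ := GRing.SubChoice_isSubPzRing.Build A centralizes
  centralizer centralizes_subring.

End Centralizer.

(* The product ring of a finite family of rings, with componentwise
   operations. *)
Definition prod_ring (I : finType) (A : I -> pzRingType) : Type :=
  {dffun forall i, A i}.

Section ProdRing.
Variables (I : finType) (A : I -> pzRingType).
Local Notation X := (prod_ring A).
Implicit Types f g h : X.

HB.instance Definition _ := Choice.on X.

Definition prod_comp f i : A i := (f : {dffun forall i, A i}) i.
Definition mk_prod (F : forall i, A i) : X := [ffun i => F i].

Lemma mk_prodE F i : prod_comp (mk_prod F) i = F i.
Proof. exact: ffunE. Qed.
Lemma prod_compP f g : (forall i, prod_comp f i = prod_comp g i) -> f = g.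
Proof. by move=> fg; apply/ffunP. Qed.

Definition prod0 := mk_prod (fun=> 0).
Definition prodN f := mk_prod (fun i => - prod_comp f i).
Definition prodD f g := mk_prod (fun i => prod_comp f i + prod_comp g i).
Definition prod1 := mk_prod (fun=> 1).
Definition prodM f g := mk_prod (fun i => prod_comp f i * prod_comp g i).

Fact prodDA : associative prodD.
Proof. by move=> f g h; apply: prod_compP => i; rewrite !mk_prodE addrA. Qed.
Fact prodDC : commutative prodD.
Proof. by move=> f g; apply: prod_compP => i; rewrite !mk_prodE addrC. Qed.
Fact prod0D : left_id prod0 prodD.
Proof. by move=> f; apply: prod_compP => i; rewrite !mk_prodE add0r. Qed.
Fact prodND : left_inverse prod0 prodN prodD.
Proof. by move=> f; apply: prod_compP => i; rewrite !mk_prodE addNr. Qed.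

HB.instance Definition _ := GRing.isZmodule.Build X prodDA prodDC prod0D prodND.

Fact prodMA : associative prodM.
Proof. by move=> f g h; apply: prod_compP => i; rewrite !mk_prodE mulrA. Qed.
Fact prod1M : left_id prod1 prodM.
Proof. by move=> f; apply: prod_compP => i; rewrite !mk_prodE mul1r. Qed.
Fact prodM1 : right_id prod1 prodM.
Proof. by move=> f; apply: prod_compP => i; rewrite !mk_prodE mulr1. Qed.
Fact prodMDl : left_distributive prodM +%R.
Proof. by move=> f g h; apply: prod_compP => i; rewrite !mk_prodE mulrDl. Qed.
Fact prodMDr : right_distributive prodM +%R.
Proof. by move=> f g h; apply: prod_compP => i; rewrite !mk_prodE mulrDr. Qed.

HB.instance Definition _ :=
  GRing.Zmodule_isPzRing.Build X prodMA prod1M prodM1 prodMDl prodMDr.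

End ProdRing.

(* Main.v *)
From HB Require Import structures.
Require Import Defs.
From mathcomp Require Import all_boot all_order all_algebra.
From mathcomp Require boolp.

(* Let p be the minimal polynomial of c, of degree d. The map
   E(a) = \sum_j p_j \sum_(i < j) c^i a c^(j-1-i), obtained by inserting a
   between the variables of (p(X) - p(Y)) / (X - Y), takes values in the
   centralizer B of c, since c E(a) - E(a) c = p(c) a - a p(c) = 0, and it is
   B-B-bilinear. As 1, c, ..., c^(d-1) are linearly independent, some matrix M
   has \tr (c^i M) = 0 for i < d-1 and \tr (c^(d-1) M) = 1; then the matrix
   units e_ij and the matrices M e_ji are dual bases for E. Hence B <= 'M_n is
   Frobenius, with \sum e_ij (x) M e_ji a Casimir element; inserting c^(d-1),
   which commutes with B, turns the latter into a separability element.
   Products are handled componentwise. *)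

Local Open Scope ring_scope.

Set Implicit Arguments.
Unset Strict Implicit.
Unset Printing Implicit Defensive.
Import GRing.Theory.

(* [fhom] is a Frobenius homomorphism with dual bases [fleft] and [fright];
   [fsep] commutes with the subring, so that
   \sum_i fleft i * fsep (x) fright i is a separability element. *)
Record frobenius_system (A : pzRingType) (P : pred A) := FrobeniusSystem {
  fhom : A -> A;
  fidx : finType;
  fleft : fidx -> A;
  fright : fidx -> A;
  fsep : A;
  fhomP : forall a, P (fhom a);
  fhomD : {morph fhom : a b / a + b};
  fhomMl : forall a b, P b -> fhom (b * a) = b * fhom a;
  fhomMr : forall a b, P b -> fhom (a * b) = fhom a * b;
  fleft_sum : forall a, \sum_i fleft i * fhom (fright i * a) = a;
  fright_sum : forall a, \sum_i fhom (a * fleft i) * fright i = a;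
  fsepC : forall b, P b -> fsep * b = b * fsep;
  fsep_sum : \sum_i fleft i * fsep * fright i = 1
}.

Section Rscale.
Variables (R T : pzRingType) (M : bimodType R T).

Lemma rscale0r (c : T) : (0 : M) *:> c = 0.
Proof. by apply: (addrI (0 *:> c)); rewrite -rscalerDl !addr0. Qed.

Lemma rscaleNr (v : M) (c : T) : (- v) *:> c = - (v *:> c).
Proof. by apply: (addrI (v *:> c)); rewrite -rscalerDl !subrr rscale0r. Qed.

End Rscale.

(** * From a Frobenius system to a separable Frobenius extension *)

Section SystemExtension.
Variables (A : pzRingType) (P : pred A) (B : subPzRingType P).
Variable S : frobenius_system P.

Local Notation incl := (val : {rmorphism B -> A}).
Local Notation idA := (idfun : {rmorphism A -> A}).
Local Notation idB := (idfun : {rmorphism B -> B}).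
Local Notation BA := (restr_bimod incl idA).
Local Notation AB := (restr_bimod idA incl).
Local Notation Hom := (lhom BA (restr_bimod idB idB)).
Local Notation x := (@fleft _ _ S).
Local Notation y := (@fright _ _ S).

Let E (a : A) : B := Sub (fhom S a) (fhomP S a).

Let val_E a : val (E a) = fhom S a. Proof. exact: SubK. Qed.

Let ED u v : E (u + v) = E u + E v.
Proof. by apply: val_inj; rewrite rmorphD /= !val_E fhomD. Qed.

Let EMl b u : E (val b * u) = b * E u.
Proof. by apply: val_inj; rewrite rmorphM /= !val_E fhomMl ?valP. Qed.

Let EMr u b : E (u * val b) = E u * b.
Proof. by apply: val_inj; rewrite rmorphM /= !val_E fhomMr ?valP. Qed.

Let E_sum (I : finType) (F : I -> A) : E (\sum_i F i) = \sum_i E (F i).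
Proof.
apply: (big_morph E ED); by apply: (addrI (E 0)); rewrite -ED !addr0.
Qed.

Let E_linear (a : A) :
  linear (fun u : BA => E ((u : A) * a) : restr_bimod idB idB).
Proof.
move=> b u v; rewrite -[RHS]/(b * E (u * a) + E (v * a)) -EMl mulrA -ED.
by rewrite -mulrDl.
Qed.

Let phi (a : A) : Hom := mk_lhom (E_linear a).

(** If f = [phi a], then f(y_i) = E(y_i a), so the first dual basis identity recovers a from the
    values of f on the y_i. *)
Let psi (f : Hom) : AB := \sum_i x i * val (lhom_app f (y i) : B).

Let phiK : cancel phi psi.
Proof.
move=> a; rewrite -[RHS](fleft_sum S) /psi; apply: eq_bigr => i _.
by rewrite mk_lhomE val_E.
Qed.

(** The y_i and the left B-linear maps u |-> E(u x_i) form a dual basis of A over B, which yields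
    both finite generation and projectivity. *)
Let expand (u : BA) : u = \sum_i E ((u : A) * x i) *: (y i : BA).
Proof.
rewrite -[LHS](fright_sum S); apply: eq_bigr => i _.
by rewrite -val_E.
Qed.

(** By [expand], f(u) is the sum of the E(u x_i) f(y_i); right B-linearity of E turns this into E(u
    psi(f)). *)
Let psiK : cancel psi phi.
Proof.
move=> f; apply: lhomP => u; rewrite mk_lhomE [in RHS](expand u).
rewrite [RHS](linear_sum (f : {linear _ -> _})) /psi mulr_sumr E_sum.
by apply: eq_bigr => i _; rewrite linearZ mulrA EMr.
Qed.

Let phi_linear (a : A) (u v : AB) : phi (a *: u + v) = a *: phi u + phi v.
Proof. by apply: lhomP => w; rewrite mk_lhomE mulrDr ED mulrA. Qed.

Let phi_rscale (u : AB) (b : B) : phi (u *:> b) = phi u *:> b.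
Proof. by apply: lhomP => w; rewrite mk_lhomE mulrA EMr. Qed.

Lemma system_frobenius_extension : frobenius_extension B.
Proof.
split.
- exists #|fidx S|, (fun i => y (enum_val i)) => u.
  exists (fun i => E ((u : A) * x (enum_val i))).
  by rewrite [LHS]expand big_enum_val.
- move=> U V p h p_surj.
  (* Choose preimages of the h(y_i) and extend them to A through the coordinates u |-> E(u x_i). *)
  have [z pz] := boolp.choice (fun i => p_surj (h (y i))).
  pose g (u : BA) := \sum_i E ((u : A) * x i) *: z i.
  have g_linear : linear g.
    move=> b u v; rewrite /g scaler_sumr -big_split; apply: eq_bigr => i _ /=.
    by rewrite scalerA -scalerDl -(E_linear (x i) b u v).
  exists (HB.pack_for {linear BA -> U} g
            (GRing.isLinear.Build _ _ _ _ g g_linear)) => u.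
  rewrite /= /g linear_sum [in RHS](expand u) linear_sum.
  by apply: eq_bigr => i _; rewrite !linearZ /= pz.
(* Bilinearity of [psi] is read off from that of [phi], which is injective. *)
- exists psi; split; last by exists phi.
  split=> [a f g | f b]; apply: (can_inj phiK).
    by rewrite phi_linear !psiK.
  by rewrite phi_rscale !psiK.
Qed.

(** The section of multiplication is a |-> sum_i x_i (x) w y_i a with w = [fsep S]; only its left
    linearity takes work. *)
Lemma system_separable_extension : separable_extension B.
Proof.
pose t (u v : A) : tensor AB BA := tens (u : AB) (v : BA).
have tZ u v a : P a -> t (u * a) v = t u (a * v).
  move=> Pa; have := tensZ (u : AB) (Sub a Pa : B) (v : BA).
  by rewrite /t -[_ *:> _]/(u * val (Sub a Pa : B))
    -[Sub a Pa *: _]/(val (Sub a Pa : B) * v) SubK.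
have t0l v : t 0 v = 0 by apply: (addrI (t 0 v)); rewrite -[LHS]tensDl !addr0.
have t0r u : t u 0 = 0 by apply: (addrI (t u 0)); rewrite -[LHS]tensDr !addr0.
have t_suml (F : fidx S -> A) v : t (\sum_j F j) v = \sum_j t (F j) v.
  by apply: (big_morph (t^~ v) _ (t0l v)) => u u'; apply: tensDl.
have t_sumr u (F : fidx S -> A) : t u (\sum_j F j) = \sum_j t u (F j).
  by apply: (big_morph (t u) _ (t0r u)) => v v'; apply: tensDr.
pose w := fsep S.
pose e (a : restr_bimod idA idA) := \sum_i t (x i) (w * y i * (a : A)).
(* Expand a x_i in the x_j: the coefficients E(y_j a x_i) lie in B, so they cross the tensor sign
   and commute with w. Summing over i then rebuilds y_j a. *)
have eC (a : A) : \sum_i t (a * x i) (w * y i) = e a.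
  transitivity (\sum_i \sum_j t (x j) (w * fhom S (y j * (a * x i)) * y i)).
    apply: eq_bigr => i _; rewrite -[in LHS](fleft_sum S (a * x i)) t_suml.
    by apply: eq_bigr => j _; rewrite tZ ?fhomP // mulrA fsepC ?fhomP.
  rewrite exchange_big; apply: eq_bigr => j _.
  rewrite -[in RHS](mulrA w) -[in RHS](fright_sum S (y j * a)) mulr_sumr t_sumr.
  by apply: eq_bigr => i _; rewrite !mulrA.
pose mul := @mult_map A P B.
have mul_tens u v : mul (t u v) = u * v by exact: mult_map_tens.
have mul0 : mul 0 = 0 := tensor_lift0 (mult_balanced B).
have mulD : {morph mul : u v / u + v} := tensor_liftD (mult_balanced B).
have mulN : {morph mul : u / - u} := tensor_liftN (mult_balanced B).
rewrite /separable_extension -/mul; split.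
  split=> [a u v | u b].
    rewrite mulD; congr (_ + _).
    elim/tensor_ind: u => [m n | | u u' hu hu' | u hu].
    - by rewrite scale_tens [LHS]mul_tens [in RHS]mul_tens -mulrA.
    - by rewrite scaler0 mul0 scaler0.
    - by rewrite scalerDr !mulD hu hu' scalerDr.
    - by rewrite scalerN !mulN hu scalerN.
  elim/tensor_ind: u => [m n | | u u' hu hu' | u hu].
  - by rewrite rscale_tens [LHS]mul_tens [in RHS]mul_tens mulrA.
  - by rewrite rscale0r mul0 rscale0r.
  - by rewrite rscalerDl !mulD hu hu' rscalerDl.
  - by rewrite rscaleNr !mulN hu rscaleNr.
exists e; split.
  split=> [a u v | u b].
    rewrite -[LHS]eC -2!eC scaler_sumr -big_split; apply: eq_bigr => i _.
    by rewrite scale_tens -[RHS]tensDl [in LHS]mulrDl -mulrA.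
  rewrite /e (big_morph (fun v => v *:> b) (id1 := 0) (op1 := +%R)).
  - by apply: eq_bigr => i _; rewrite rscale_tens mulrA.
  - by move=> v v'; rewrite rscalerDl.
  - exact: rscale0r.
move=> a; rewrite /e (big_morph _ mulD mul0).
rewrite -[RHS]mul1r -(fsep_sum S) mulr_suml; apply: eq_bigr => i _.
by rewrite mul_tens !mulrA.
Qed.

End SystemExtension.

(** * Matrix units and the trace form *)

Lemma delta_mx_sandwich (R : pzSemiRingType) n (X : 'M[R]_n) (i j : 'I_n) :
  delta_mx i j *m X *m delta_mx j i = X j j *: delta_mx i i.
Proof.
apply/matrixP => a b; rewrite !mxE (bigD1 j) //= big1 ?addr0; last first.
  by move=> l lj; rewrite [delta_mx j i _ _]mxE (negPf lj) mulr0.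
rewrite !mxE (bigD1 j) //= big1 ?addr0; last first.
  by move=> l lj; rewrite mxE (negPf lj) andbF mul0r.
by rewrite !mxE !eqxx andbT; case: (a == i); case: (b == i);
  rewrite ?(mul0r, mul1r, mulr0, mulr1).
Qed.

Lemma sum_delta_mx_sandwich (R : pzSemiRingType) n (X : 'M[R]_n) :
  \sum_(ij : 'I_n * 'I_n) delta_mx ij.1 ij.2 *m X *m delta_mx ij.2 ij.1
    = (\tr X)%:M.
Proof.
rewrite -(pair_bigA _ (fun i j => delta_mx i j *m X *m delta_mx j i)) /=.
rewrite scalar_mx_sum_delta; apply: eq_bigr => i _.
by rewrite scaler_suml; apply: eq_bigr => j _; exact: delta_mx_sandwich.
Qed.

(** Identifies linear functionals on matrices, given by column vectors, with traces against a fixed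
    matrix. *)
Lemma mxvec_mul_trmx (R : pzRingType) m n
    (X : 'M[R]_(m, n)) (Y : 'M[R]_(n, m)) :
  mxvec X *m (mxvec Y^T)^T = (\tr (X *m Y))%:M.
Proof.
apply/matrixP => i j; rewrite !ord1 !mxE mulr1n.
transitivity (\sum_a \sum_b X a b * Y b a); last first.
  by apply: eq_bigr => a _; rewrite mxE.
rewrite pair_bigA (reindex _ (curry_mxvec_bij _ _)).
by apply: eq_bigr => [[a b]] _; rewrite /= mxE !mxvecE mxE.
Qed.

(** * The Frobenius homomorphism as a divided difference *)

Section Bezoutian.
Variables (R : comNzRingType) (A : algType R) (p : {poly R}) (c : A).

(** The inner sum is (X^j - Y^j) / (X - Y), with X acting as c on the left of [a] and Y as c on the
    right; as i < j, the truncated subtraction is exact. *)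
Definition bezoutian (a : A) : A :=
  \sum_(j < size p) p`_j *: \sum_(i < j) c ^+ i * a * c ^+ (j - i.+1).

Lemma bezoutianD : {morph bezoutian : a b / a + b}.
Proof.
move=> a b; rewrite -big_split; apply: eq_bigr => j _ /=.
rewrite -scalerDr -big_split; congr (_ *: _); apply: eq_bigr => i _ /=.
by rewrite mulrDr mulrDl.
Qed.

Lemma bezoutianMl a b : GRing.comm b c -> bezoutian (b * a) = b * bezoutian a.
Proof.
move=> bc; rewrite /bezoutian mulr_sumr; apply: eq_bigr => j _.
rewrite -scalerAr mulr_sumr; congr (_ *: _); apply: eq_bigr => i _.
by rewrite !mulrA (commrX i bc).
Qed.

Lemma bezoutianMr a b : GRing.comm b c -> bezoutian (a * b) = bezoutian a * b.
Proof.
move=> bc; rewrite /bezoutian mulr_suml; apply: eq_bigr => j _.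
rewrite -scalerAl mulr_suml; congr (_ *: _); apply: eq_bigr => i _.
by rewrite -!mulrA (commrX _ bc).
Qed.

Lemma bezoutian_comm a :
  \sum_(j < size p) p`_j *: c ^+ j = 0 -> bezoutian a * c = c * bezoutian a.
Proof.
move=> pc0; apply/esym/eqP; rewrite -subr_eq0; apply/eqP.
transitivity ((\sum_(j < size p) p`_j *: c ^+ j) * a
    - a * \sum_(j < size p) p`_j *: c ^+ j); last first.
  by rewrite pc0 mul0r mulr0 subrr.
rewrite /bezoutian !mulr_sumr !mulr_suml -!sumrB; apply: eq_bigr => j _.
rewrite -!scalerAl -!scalerAr -!scalerBr; congr (_ *: _).
rewrite mulr_sumr mulr_suml -sumrB.
(* For fixed j the commutator telescopes: [F] runs from a c^j at i = 0 to c^j a at i = j. *)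
pose F i := c ^+ i * a * c ^+ (j - i).
transitivity (\sum_(0 <= i < j) (F i.+1 - F i)); last first.
  by rewrite telescope_sumr // /F subnn subn0 !expr0 mulr1 mul1r.
rewrite big_mkord; apply: eq_bigr => i _; congr (_ - _).
  by rewrite /F exprS !mulrA.
by rewrite /F -[LHS]mulrA -exprSr subnSK.
Qed.

End Bezoutian.

(** * The Frobenius system of a matrix centralizer *)

Lemma horner_mx_sum (R : comNzRingType) n (c : 'M[R]_n.+1) (p : {poly R}) :
  horner_mx c p = \sum_(j < size p) p`_j *: c ^+ j.
Proof.
rewrite -[in LHS](coefK p) poly_def linear_sum; apply: eq_bigr => j _.
by rewrite linearZ /= rmorphXn /= horner_mx_X.
Qed.

(** The powers of c below the degree d, flattened to rows, form a row-free matrix. The last column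
    of a right inverse kills all of them but c^(d-1), and is a trace against some [M]. *)
Lemma mxminpoly_dual (k : fieldType) n (c : 'M[k]_n.+1) :
  exists M : 'M[k]_n.+1, forall i, (i < degree_mxminpoly c)%N ->
    \tr (c ^+ i *m M) = (i.+1 == degree_mxminpoly c)%:R.
Proof.
have [N cN] := row_freeP (minpoly_mx_free c).
have dP : ((degree_mxminpoly c).-1 < degree_mxminpoly c)%N.
  by rewrite prednK ?mxminpoly_nonconstant.
pose M := (vec_mx (col (Ordinal dP) N)^T)^T.
have colN : col (Ordinal dP) N = (mxvec M^T)^T by rewrite trmxK vec_mxK trmxK.
exists M => i id.
have := congr1 (fun X => col (Ordinal dP) (row (Ordinal id) X)) cN.
rewrite row_mul rowK colE -mulmxA -colE colN mxvec_mul_trmx.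
move/matrixP/(_ 0 0); rewrite !mxE /= !mulr1n => ->.
by rewrite -val_eqE -eqSS /= prednK ?mxminpoly_nonconstant.
Qed.

(** Stated with [inhabited] because [M] is only known to exist as a proposition, while a system is
    data. *)
Lemma matrix_frobenius_system (k : fieldType) n (c : 'M[k]_n.+1) :
  inhabited (frobenius_system (centralizes c)).
Proof.
have [M cM] := mxminpoly_dual c.
set d := degree_mxminpoly c in cM.
pose E := bezoutian (mxminpoly c) c.
have comm b : centralizes c b -> GRing.comm b c by move/eqP.
(* The trace vanishes unless i = d-1, and i < j <= d then forces j = d. The surviving term has
   coefficient 1, the minimal polynomial being monic, and second exponent 0. *)
have top (F : nat -> nat -> 'M[k]_n.+1) :
    \sum_(j < size (mxminpoly c)) (mxminpoly c)`_j *: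
      \sum_(i < j) \tr (c ^+ i *m M) *: F i (j - i.+1)%N = F d.-1 0%N.
  rewrite size_mxminpoly big_ord_recr /= -/d.
  have -> : (mxminpoly c)`_d = 1.
    by have /monicP := mxminpoly_monic c; rewrite lead_coefE size_mxminpoly.
  have d_gt0 : (0 < d)%N := mxminpoly_nonconstant c.
  rewrite big1 ?add0r ?scale1r => [|j _].
    have dP : (d.-1 < d)%N by rewrite prednK.
    rewrite (bigD1 (Ordinal dP)) //= big1 ?addr0 => [|i ne].
      by rewrite cM // prednK // eqxx scale1r subnn.
    rewrite cM // (_ : _ == d = false) ?scale0r //.
    by apply: contraNF ne => /eqP id; apply/eqP/val_inj;
      rewrite /= -[in RHS]id.
  rewrite big1 ?scaler0 // => i _.
  rewrite cM ?(ltn_trans (ltn_ord i)) // (_ : _ == d = false) ?scale0r //.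
  by rewrite ltn_eqF // (leq_ltn_trans (ltn_ord i)).
have pc0 := mx_root_minpoly c; rewrite horner_mx_sum in pc0.
constructor.
apply: (@FrobeniusSystem _ _ E ('I_n.+1 * 'I_n.+1)%type
  (fun ij => delta_mx ij.1 ij.2) (fun ij => M * delta_mx ij.2 ij.1)
  (c ^+ d.-1)).
- by move=> a; apply/eqP/bezoutian_comm.
- exact: bezoutianD.
- by move=> a b /comm; apply: bezoutianMl.
- by move=> a b /comm; apply: bezoutianMr.
(* Write a as a c^0 and apply [top] backwards; each trace tr(c^i M) is then the sum of e_ij c^i M
   e_ji over all matrix units. *)
- move=> a; rewrite -[RHS]mulr1 -[RHS](top (fun _ q => a * c ^+ q)).
  under eq_bigr => ij _ do rewrite mulr_sumr.
  rewrite exchange_big; apply: eq_bigr => j _ /=.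
  under eq_bigr => ij _ do rewrite -scalerAr mulr_sumr.
  rewrite -scaler_sumr exchange_big; congr (_ *: _); apply: eq_bigr => i _ /=.
  rewrite -mul_scalar_mx -sum_delta_mx_sandwich mulmx_suml.
  by apply: eq_bigr => ij _; rewrite !mulmxE !mulrA.
- move=> a; rewrite -[RHS]mul1r -[RHS](top (fun _ q => c ^+ q * a)).
  under eq_bigr => ij _ do rewrite mulr_suml.
  rewrite exchange_big; apply: eq_bigr => j _ /=.
  under eq_bigr => ij _ do rewrite -scalerAl mulr_suml.
  rewrite -scaler_sumr exchange_big; congr (_ *: _).
  (* Here the matrix units enclose the power of c to the right of [a], so the inner sum is reversed
     to give that power the exponent i. *)
  rewrite (reindex_inj rev_ord_inj); apply: eq_bigr => i _ /=.
  rewrite subnSK // subKn 1?ltnW // -mul_mx_scalar -sum_delta_mx_sandwich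
    mulmx_sumr.
  by apply: eq_bigr => ij _; rewrite !mulmxE !mulrA.
- by move=> b /comm bc; apply/esym/commrX.
(* The sum collapses to the scalar tr(c^(d-1) M) = 1. *)
- rewrite (eq_bigr (fun ij => delta_mx ij.1 ij.2 *m (c ^+ d.-1 * M)
     *m delta_mx ij.2 ij.1)) => [|ij _]; last by rewrite !mulmxE !mulrA.
  rewrite sum_delta_mx_sandwich cM ?prednK ?mxminpoly_nonconstant //.
  by rewrite eqxx.
Qed.

(** * Frobenius systems on finite products *)

Section ProductSystem.
Variables (I : finType) (A : I -> pzRingType) (c : prod_ring A).
Variable S : forall i, frobenius_system (centralizes (prod_comp c i)).

Lemma prod_comp_centralizes b i :
  centralizes c b -> centralizes (prod_comp c i) (prod_comp b i).
Proof.
by move=> /eqP /(congr1 (fun u => prod_comp u i)); rewrite !mk_prodE => /eqP.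
Qed.

Lemma prod_comp_sum (J : finType) (F : J -> prod_ring A) i :
  prod_comp (\sum_j F j) i = \sum_j prod_comp (F j) i.
Proof.
by apply: (big_morph (fun u => prod_comp u i)) => [u v|]; apply: mk_prodE.
Qed.

Definition prod_inj i (a : A i) : prod_ring A := mk_prod (dfwith (fun=> 0) a).

(** The dual bases are indexed by the disjoint union of those of the factors, each element being
    extended by zero to the other components. *)
Lemma prod_frobenius_system : frobenius_system (centralizes c).
Proof.
pose E (a : prod_ring A) : prod_ring A :=
  mk_prod (fun i => fhom (S i) (prod_comp a i)).
pose x (p : {i : I & fidx (S i)}) := prod_inj (fleft (tagged p)).
pose y (p : {i : I & fidx (S i)}) := prod_inj (fright (tagged p)).
(* In component i only basis elements coming from the i-th factor contribute, which reduces each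
   identity to the one for that factor. *)
have collapse i (F : forall j, fidx (S j) -> A i) :
    (forall j, j != i -> forall l, F j l = 0) ->
    \sum_(p : {j : I & fidx (S j)}) F (tag p) (tagged p) = \sum_l F i l.
  move=> F0; rewrite -(sig_big_dep xpredT (fun _ => xpredT) F) /=.
  by rewrite (bigD1 i) //= [X in _ + X]big1 ?addr0 // => j /F0 Fj;
    rewrite big1.
have injE i (a : A i) : prod_comp (prod_inj a) i = a.
  by rewrite mk_prodE dfwith_in.
have inj0 i j (a : A i) : i != j -> prod_comp (prod_inj a) j = 0.
  by move=> ij; rewrite mk_prodE dfwith_out.
apply: (@FrobeniusSystem _ _ E {i : I & fidx (S i)} x y
  (mk_prod (fun i => fsep (S i)))).
- by move=> a; apply/eqP/prod_compP => i; rewrite !mk_prodE;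
  apply/eqP; exact: (fhomP (S i)).
- by move=> a b; apply: prod_compP => i; rewrite !mk_prodE fhomD.
- move=> a b bc; apply: prod_compP => i; rewrite !mk_prodE fhomMl //.
  exact: prod_comp_centralizes.
- move=> a b bc; apply: prod_compP => i; rewrite !mk_prodE fhomMr //.
  exact: prod_comp_centralizes.
- move=> a; apply: prod_compP => i; rewrite prod_comp_sum.
  rewrite (collapse i (fun j l => prod_comp (prod_inj (fleft l)
    * E (prod_inj (fright l) * a)) i)) => [|j ji l].
    rewrite -[RHS](fleft_sum (S i)); apply: eq_bigr => l _.
    by rewrite [LHS]mk_prodE !injE !mk_prodE dfwith_in.
  by rewrite mk_prodE inj0 // mul0r.
- move=> a; apply: prod_compP => i; rewrite prod_comp_sum.
  rewrite (collapse i (fun j l => prod_comp (E (a * prod_inj (fleft l))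
    * prod_inj (fright l)) i)) => [|j ji l].
    rewrite -[RHS](fright_sum (S i)); apply: eq_bigr => l _.
    by rewrite [LHS]mk_prodE !injE !mk_prodE dfwith_in.
  by rewrite mk_prodE [X in _ * X]inj0 // mulr0.
- move=> b bc; apply: prod_compP => i; rewrite !mk_prodE fsepC //.
  exact: prod_comp_centralizes.
- apply: prod_compP => i; rewrite prod_comp_sum [RHS]mk_prodE.
  rewrite (collapse i (fun j l => prod_comp (prod_inj (fleft l)
    * mk_prod (fun i => fsep (S i)) * prod_inj (fright l)) i)) => [|j ji l].
    rewrite -[RHS](fsep_sum (S i)); apply: eq_bigr => l _.
    by rewrite !mk_prodE !dfwith_in.
  by rewrite mk_prodE [X in _ * X]inj0 // mulr0.
Qed.

End ProductSystem.

(** * Centralizers in matrix rings and in their finite products *)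

Theorem corollary3p11 (k : closedFieldType) :
  (forall n : nat, (0 < n)%N ->
    forall c : 'M[k]_n,
      separable_extension (centralizer c) /\
      frobenius_extension (centralizer c))
  /\
  (forall s : nat, (0 < s)%N ->
    forall n : 'I_s -> nat, (forall i : 'I_s, (0 < n i)%N) ->
    forall c : prod_ring (fun i : 'I_s => 'M[k]_(n i)),
      separable_extension (centralizer c) /\
      frobenius_extension (centralizer c)).
Proof.
have mx n (n_gt0 : (0 < n)%N) (c : 'M[k]_n) :
    inhabited (frobenius_system (centralizes c)).
  by case: n n_gt0 c => // n _ c; apply: matrix_frobenius_system.
split=> [n n_gt0 c | s _ n n_gt0 c].
  have [S] := mx n n_gt0 c.
  by split; [exact: system_separable_extension S
            | exact: system_frobenius_extension S].
(* Each factor is only known to have some system; choice selects one for every i. *)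
have S := prod_frobenius_system
  (fun i => boolp.inhabited_witness (mx _ (n_gt0 i) (prod_comp c i))).
by split; [exact: system_separable_extension S
          | exact: system_frobenius_extension S].
Qed.
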